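(* Let $\overline{\bm{p}}_{sa}\in\Delta_S$ with $\overline{\bm{p}}_{sa}>\bm{0}$, let $\bm{b}\in\mathbb{R}^S_+$ and $\beta\in\mathbb{R}_+$ with $\bm{b}^\top\overline{\bm{p}}_{sa}>\beta$, and consider the projection problem $$\mathfrak{P}(\overline{\bm{p}}_{sa};\bm{b},\beta)=\min\left\{\sum_{s'\in\mathcal{S}}\overline{p}_{sas'}\,\phi\!\left(\frac{p_{sas'}}{\overline{p}_{sas'}}\right) : \bm{b}^\top\bm{p}_{sa}\le\beta,\ \bm{p}_{sa}\in\Delta_S\right\}$$ for the Burg entropy $\phi(t)=-\log t+t-1$. If $\beta\ge\min\{\bm{b}\}+\omega$ for some $\omega>0$, then the projection problem can be solved to any $\delta$-accuracy, $\delta>0$, in time $$\mathcal{O}\left(S\cdot\log\left[\frac{\max\{\bm{b}\}}{\delta\,\omega}\right]\right).$$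
   Context: $\mathcal{S}=\{1,\dots,S\}$; $\Delta_S=\{\bm{p}\in\mathbb{R}^S_+ : \sum_{s'}p_{s'}=1\}$; the subscript $sa$ is a fixed index (state-action pair). $\min\{\bm{x}\}$ and $\max\{\bm{x}\}$ denote the smallest and largest component of a vector $\bm{x}$. Convention $\log 0=-\infty$, so $\phi(0)=+\infty$. The projection problem is solved to $\delta$-accuracy by any pair $(\underline{d},\overline{d})\in\mathbb{R}^2$ with $\mathfrak{P}(\overline{\bm{p}}_{sa};\bm{b},\beta)\in[\underline{d},\overline{d}]$ and $\overline{d}-\underline{d}\le\delta$. Running time counts elementary operations on real numbers (arithmetic, comparisons, evaluations of elementary functions such as $\exp$ and $\log$), each at unit cost. *)

(* Defs.v *)
From mathcomp Require Import all_boot all_order all_algebra.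
From mathcomp Require Import all_classical all_reals all_analysis.
Set Implicit Arguments.
Unset Strict Implicit.
Unset Printing Implicit Defensive.
Import Order.TTheory GRing.Theory Num.Theory.
Local Open Scope classical_set_scope.
Local Open Scope ring_scope.

Section Projection.
Variables (R : realType) (n : nat).
Implicit Types (u v p pbar b : 'rV[R]_n.+1) (beta delta : R).

Definition dot u v : R := \sum_s u 0 s * v 0 s.

(* The seed u 0 ord0 is itself a component, so these are the exact extrema. *)
Definition vmin u : R := \big[Num.min/u 0 ord0]_s u 0 s.
Definition vmax u : R := \big[Num.max/u 0 ord0]_s u 0 s.

Definition simplex : set 'rV[R]_n.+1 :=
  [set p | (forall s, 0 <= p 0 s) /\ \sum_s p 0 s = 1].

(* The value +oo at 0 is the convention log 0 = -oo; it has to be written out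
   because [ln 0 = 0] in the library.  Negative t never occur below. *)
Definition burg (t : R) : \bar R :=
  if 0 < t then (- ln t + t - 1)%:E else +oo%E.

Definition burg_divergence pbar p : \bar R :=
  (\sum_s (pbar 0%R s)%:E * burg (p 0%R s / pbar 0%R s)%R)%E.

Definition feasible b beta : set 'rV[R]_n.+1 :=
  [set p | dot b p <= beta /\ simplex p].

(* d is the (attained) minimum of the projection problem. *)
Definition is_projection_value pbar b beta (d : \bar R) : Prop :=
  let values := burg_divergence pbar @` feasible b beta in
  values d /\ lbound values d.

Definition solves_to_accuracy pbar b beta delta (dlo dhi : R) : Prop :=
  (exists2 d : \bar R, is_projection_value pbar b beta d
                     & (dlo%:E <= d <= dhi%:E)%E)
  /\ dhi - dlo <= delta.

End Projection.

(* A real random access machine, presented as a small imperative language.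
   A memory has integer registers (used for loop counters and array indices),
   real registers, and real arrays.  The only real constants are the
   integers, so a program is a finite object that does not depend on R; there
   is no rounding and no conversion between real and integer registers. *)

Inductive iexp : Type :=
| IConst of nat
| IReg of nat
| IAdd of iexp & iexp
| ISub of iexp & iexp.  (* truncated *)

Inductive rexp : Type :=
| RConst of nat
| RReg of nat
| RGet of nat & iexp  (* RGet a i: cell i of array number a *)
| RAdd of rexp & rexp
| RSub of rexp & rexp
| RMul of rexp & rexp
| RDiv of rexp & rexp
| RExp of rexp
| RLn of rexp.

Inductive test : Type :=
| RLe of rexp & rexp
| ILt of iexp & iexp.

Inductive cmd : Type :=
| Skip
| ISet of nat & iexp
| RSet of nat & rexp
| RPut of nat & iexp & rexp  (* RPut a i e: cell i of array a := e *)
| Seq of cmd & cmd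
| If of test & cmd & cmd
| While of test & cmd.

(* Every node of an expression counts for one time unit: each operation, but
   also each memory access and each constant. *)
Fixpoint icost (e : iexp) : nat :=
  match e with
  | IConst _ | IReg _ => 1
  | IAdd e1 e2 | ISub e1 e2 => (icost e1 + icost e2).+1
  end.

Fixpoint rcost (e : rexp) : nat :=
  match e with
  | RConst _ | RReg _ => 1
  | RGet _ i => (icost i).+1
  | RAdd e1 e2 | RSub e1 e2 | RMul e1 e2 | RDiv e1 e2 =>
      (rcost e1 + rcost e2).+1
  | RExp e1 | RLn e1 => (rcost e1).+1
  end.

Definition tcost (c : test) : nat :=
  match c with
  | RLe e1 e2 => (rcost e1 + rcost e2).+1
  | ILt e1 e2 => (icost e1 + icost e2).+1
  end.

Section Machine.
Variable R : realType.

Record memory : Type := Memory {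
  ireg : nat -> nat;
  rreg : nat -> R;
  rarr : nat -> nat -> R
}.

Implicit Types m : memory.

Definition upd (T : Type) (f : nat -> T) (k : nat) (v : T) : nat -> T :=
  fun j => if j == k then v else f j.

Fixpoint ieval m (e : iexp) : nat :=
  match e with
  | IConst k => k
  | IReg x => ireg m x
  | IAdd e1 e2 => (ieval m e1 + ieval m e2)%N
  | ISub e1 e2 => (ieval m e1 - ieval m e2)%N
  end.

Definition map2o (f : R -> R -> option R) (x y : option R) : option R :=
  obind (fun a => obind (f a) y) x.

(* None on division by zero and on the logarithm of a nonpositive number: a
   program performing such an operation is stuck. *)
Fixpoint reval m (e : rexp) : option R :=
  match e with
  | RConst k => Some k%:R
  | RReg x => Some (rreg m x)
  | RGet a i => Some (rarr m a (ieval m i))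
  | RAdd e1 e2 => map2o (fun x y => Some (x + y)) (reval m e1) (reval m e2)
  | RSub e1 e2 => map2o (fun x y => Some (x - y)) (reval m e1) (reval m e2)
  | RMul e1 e2 => map2o (fun x y => Some (x * y)) (reval m e1) (reval m e2)
  | RDiv e1 e2 => map2o (fun x y => if y == 0 then None else Some (x / y))
                        (reval m e1) (reval m e2)
  | RExp e1 => omap expR (reval m e1)
  | RLn e1 => obind (fun x => if 0 < x then Some (ln x) else None)
                    (reval m e1)
  end.

Definition teval m (c : test) : option bool :=
  match c with
  | RLe e1 e2 =>
      obind (fun x => omap (fun y => x <= y) (reval m e2)) (reval m e1)
  | ILt e1 e2 => Some (ieval m e1 < ieval m e2)%N
  end.

Definition iset m (x k : nat) : memory :=
  Memory (upd (ireg m) x k) (rreg m) (rarr m).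

Definition rset m (x : nat) (v : R) : memory :=
  Memory (ireg m) (upd (rreg m) x v) (rarr m).

Definition rput m (a i : nat) (v : R) : memory :=
  Memory (ireg m) (rreg m) (upd (rarr m) a (upd (rarr m a) i v)).

(* [exec c m m' t]: started in m, the command c terminates in m' after exactly
   t time units.  The relation is deterministic. *)
Inductive exec : cmd -> memory -> memory -> nat -> Prop :=
| ExecSkip m : exec Skip m m 0
| ExecISet m x e : exec (ISet x e) m (iset m x (ieval m e)) (icost e).+1
| ExecRSet m x e v : reval m e = Some v ->
    exec (RSet x e) m (rset m x v) (rcost e).+1
| ExecRPut m a i e v : reval m e = Some v ->
    exec (RPut a i e) m (rput m a (ieval m i) v) (icost i + rcost e).+1
| ExecSeq c1 c2 m1 m2 m3 t1 t2 :
    exec c1 m1 m2 t1 -> exec c2 m2 m3 t2 ->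
    exec (Seq c1 c2) m1 m3 (t1 + t2)
| ExecIfTrue c c1 c2 m m' t : teval m c = Some true ->
    exec c1 m m' t -> exec (If c c1 c2) m m' (tcost c + t)
| ExecIfFalse c c1 c2 m m' t : teval m c = Some false ->
    exec c2 m m' t -> exec (If c c1 c2) m m' (tcost c + t)
| ExecWhileTrue c c1 m1 m2 m3 t1 t2 : teval m1 c = Some true ->
    exec c1 m1 m2 t1 -> exec (While c c1) m2 m3 t2 ->
    exec (While c c1) m1 m3 (tcost c + t1 + t2)
| ExecWhileFalse c c1 m : teval m c = Some false ->
    exec (While c c1) m m (tcost c).

Definition vec_array (n : nat) (u : 'rV[R]_n) (k : nat) : R :=
  if insub k is Some i then u 0 i else 0.

(* Input: the dimension in integer register 0, beta and delta in real registers
   0 and 1, pbar and b in arrays 0 and 1; everything else is zero. *)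
Definition input (n : nat) (pbar b : 'rV[R]_n) (beta delta : R) : memory :=
  Memory (upd (fun=> 0%N) 0 n)
         (upd (upd (fun=> 0) 0 beta) 1 delta)
         (upd (upd (fun=> fun=> 0) 0 (vec_array pbar)) 1 (vec_array b)).

(* [solves_within c pbar b beta delta T]: on this input, c terminates within T
   time units, with a solution to accuracy delta in real registers 0 and 1. *)
Definition solves_within (c : cmd) (n : nat) (pbar b : 'rV[R]_n.+1)
    (beta delta T : R) : Prop :=
  exists m t, [/\ exec c (input pbar b beta delta) m t,
    solves_to_accuracy pbar b beta delta (rreg m 0) (rreg m 1) & t%:R <= T].

End Machine.

(* Main.v *)
Require Import Defs.
From mathcomp Require Import all_boot all_order all_algebra.
From mathcomp Require Import all_classical all_reals all_analysis.
From mathcomp Require Import ring lra zify.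
Import Order.TTheory GRing.Theory Num.Theory.
Import numFieldNormedType.Exports.
Local Open Scope ring_scope.

Set Implicit Arguments.
Unset Strict Implicit.
Unset Printing Implicit Defensive.

(* By Lagrangian duality the optimal value is the maximum over a in
   [0, 1 / (beta - min b)) of the concave function
     g a = \sum_s pbar_s ln (1 + a (b_s - beta)),
   the optimal p being pbar_s / (1 + a (b_s - beta)) at the root a of g'.
   Bisection on the sign of g' keeps an interval [lo, lo + w] around that root;
   by concavity g lo <= max g <= g lo + g' lo * w <= g lo + g' 0 * w.
   Since g' 0 = b^T pbar - beta <= max b and w starts below 1 / omega, the error
   drops below delta after log2 (max b / (delta omega)) + 1 halvings, each of
   which costs one pass over the data. *)

(** * Lagrangian duality for the projection problem *)

Section Dual.
Variables (R : realType) (n : nat) (pbar b : 'rV[R]_n.+1) (beta : R).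
Implicit Types (a c : R) (p : 'rV[R]_n.+1) (s : 'I_n.+1).

Definition denom a s : R := 1 + a * (b 0 s - beta).

Definition dual a : R := \sum_s pbar 0 s * ln (denom a s).

Definition dual_slope a : R := \sum_s pbar 0 s * (b 0 s - beta) / denom a s.

Hypothesis pbar_simplex : simplex pbar.
Hypothesis pbar_gt0 : forall s, 0 < pbar 0 s.

Lemma sum_mul_denom a p : simplex p ->
  \sum_s p 0 s * denom a s = 1 + a * (dot b p - beta).
Proof.
move=> [_ p1]; rewrite mulrBr /dot mulr_sumr.
rewrite -[X in a * X](mulr1 beta) -{2}p1 2!mulr_sumr -sumrB -{1}p1 -big_split.
by apply: eq_bigr => s _ /=; rewrite /denom; ring.
Qed.

Lemma dual_slope0 : dual_slope 0 = dot b pbar - beta.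
Proof.
have [_ p1] := pbar_simplex.
rewrite -[beta in RHS]mulr1 -p1 mulr_sumr -sumrB.
by apply: eq_bigr => s _; rewrite /denom mul0r addr0 divr1; ring.
Qed.

(** Termwise: after clearing denominators, the difference is
    [pbar 0 s * (b 0 s - beta) ^+ 2 * (c - a)]. *)
Lemma dual_slope_nonincreasing a c : a <= c ->
  (forall s, 0 < denom a s) -> (forall s, 0 < denom c s) ->
  dual_slope c <= dual_slope a.
Proof.
move=> ac a0 c0; apply: ler_sum => s _.
rewrite ler_pdivrMr // mulrAC ler_pdivlMr // -subr_ge0 /denom.
have -> : pbar 0 s * (b 0 s - beta) * (1 + c * (b 0 s - beta)) -
    pbar 0 s * (b 0 s - beta) * (1 + a * (b 0 s - beta)) =
    pbar 0 s * (b 0 s - beta) ^+ 2 * (c - a) by ring.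
by rewrite mulr_ge0 ?subr_ge0// mulr_ge0 ?sqr_ge0// ltW.
Qed.

Lemma ln_le_subr1 (x : R) : 0 < x -> ln x <= x - 1.
Proof.
move=> x0; rewrite -[in ln x](subrK 1 x) addrC; apply: le_ln1Dx; lra.
Qed.

(** Termwise tangent inequality, from ln x <= x - 1 at x = [denom c s / denom a s]. *)
Lemma dual_concave a c :
  (forall s, 0 < denom a s) -> (forall s, 0 < denom c s) ->
  dual c <= dual a + dual_slope a * (c - a).
Proof.
move=> a0 c0; rewrite mulr_suml -big_split; apply: ler_sum => s _ /=.
have pa := a0 s; have pc := c0 s.
have : ln (denom c s / denom a s) <= denom c s / denom a s - 1.
  by rewrite ln_le_subr1// divr_gt0.
rewrite ln_div// lerBlDl => h.
have -> : pbar 0 s * (b 0 s - beta) / denom a s * (c - a) =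
    pbar 0 s * ((b 0 s - beta) / denom a s * (c - a)) by rewrite !mulrA.
rewrite -mulrDr ler_pM2l//; apply: (le_trans h); rewrite lerD2l le_eqVlt.
apply/orP; left; apply/eqP.
have -> : denom c s = denom a s + (b 0 s - beta) * (c - a).
  by rewrite /denom; ring.
by rewrite mulrDl divff ?gt_eqF// addrC addKr mulrAC.
Qed.

(** With t = p_s / pbar_s and d = [denom a s], the bound ln (t d) <= t d - 1 gives phi(t) >= ln d +
    t - t d; weight by pbar_s and sum. *)
Lemma weak_duality a p : 0 <= a -> (forall s, 0 < denom a s) ->
  feasible b beta p -> ((dual a)%:E <= burg_divergence pbar p)%E.
Proof.
move=> a0 d0 [bp sp]; have [p0 p1] := sp; have [_ pbar1] := pbar_simplex.
(* Feasibility bounds the sum of p_s [denom a s] by 1, which is the sum of p_s. The factor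
   [1 - a * 0] is just 1. *)
have le1 : dual a <= \sum_s (pbar 0 s * (ln (denom a s))
    + (1 - a * 0) * p 0 s - p 0 s * denom a s).
  rewrite sumrB big_split /= -mulr_sumr p1 sum_mul_denom// /dual.
  have : a * (dot b p - beta) <= 0 by rewrite mulr_ge0_le0// subr_le0.
  by rewrite mulr0 subr0 mulr1; lra.
apply: (@le_trans _ _ (\sum_s (pbar 0 s * ln (denom a s)
    + p 0 s - p 0 s * denom a s)%:E)%E).
  by rewrite sumEFin lee_fin; apply: (le_trans le1); apply: ler_sum => s _; lra.
apply: lee_sum => s _.
have ps := pbar_gt0 s.
rewrite /burg; case: ifPn => [t0|_]; last by rewrite gt0_muley ?lte_fin// leey.
rewrite -EFinM lee_fin.
have : ln (p 0 s / pbar 0 s * denom a s) <= p 0 s / pbar 0 s * denom a s - 1.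
  by rewrite ln_le_subr1// mulr_gt0.
rewrite lnM ?posrE// => h.
set t := _ / _ in t0 h *.
have -> : p 0 s = pbar 0 s * t by rewrite /t mulrCA divff ?mulr1// gt_eqF.
rewrite -mulrA -mulrDr -mulrBr ler_pM2l//.
lra.
Qed.

(** A zero slope makes pbar_s / [denom a s] a probability vector that meets the constraint with
    equality; its divergence is [dual a]. *)
Lemma strong_duality a : 0 <= a -> (forall s, 0 < denom a s) ->
  dual_slope a = 0 -> is_projection_value pbar b beta (dual a)%:E.
Proof.
move=> a0 d0 slope0; split; last by move=> _ [p fp <-]; exact: weak_duality.
have [_ pbar1] := pbar_simplex.
pose p : 'rV[R]_n.+1 := \row_s (pbar 0 s / denom a s).
have pE s : p 0 s = pbar 0 s / denom a s by rewrite mxE.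
have pd s : p 0 s * denom a s = pbar 0 s by rewrite pE divfK// gt_eqF.
have bp : \sum_s p 0 s * (b 0 s - beta) = 0.
  rewrite -[RHS]slope0; apply: eq_bigr => s _; by rewrite pE mulrAC.
have p1 : \sum_s p 0 s = 1.
  have -> : \sum_s p 0 s = \sum_s p 0 s * denom a s - a * \sum_s p 0 s * (b 0 s - beta).
    by rewrite mulr_sumr -sumrB; apply: eq_bigr => s _; rewrite /denom; ring.
  by rewrite bp mulr0 subr0 -pbar1; apply: eq_bigr => s _; rewrite pd.
have sp : simplex p by split=> // s; rewrite pE ltW// divr_gt0.
exists p.
  have bpE : \sum_s p 0 s * (b 0 s - beta) = dot b p - beta.
    rewrite -[in RHS](mulr1 beta) -p1 mulr_sumr -sumrB.
    by apply: eq_bigr => s _; ring.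
  by split=> //; rewrite -subr_le0 -bpE bp.
have -> : dual a = \sum_s (pbar 0 s * ln (denom a s) + p 0 s - pbar 0 s).
  by rewrite sumrB big_split /= p1 pbar1 addrK.
rewrite /burg_divergence -sumEFin.
apply: eq_bigr => s _ /=.
have -> : p 0 s / pbar 0 s = (denom a s)^-1.
  by rewrite pE mulrAC divff ?mul1r// gt_eqF.
rewrite /burg invr_gt0 d0 -EFinM lnV ?posrE// pE.
by congr _%:E; ring.
Qed.

Hypothesis beta_lt_dot : beta < dot b pbar.

Variable m : R.
Hypothesis m_lt_beta : m < beta.
Hypothesis m_le : forall s, m <= b 0 s.

(** The denominator is at least 1 - a (beta - m). *)
Lemma denom_gt0 a s : 0 <= a -> a < (beta - m)^-1 -> 0 < denom a s.
Proof.
move=> a0 am; have bm : 0 < beta - m by rewrite subr_gt0.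
have : a * (beta - m) < 1 by rewrite -ltr_pdivlMr// div1r.
have : a * (m - b 0 s) <= 0 by rewrite mulr_ge0_le0// subr_le0.
by rewrite /denom; lra.
Qed.

Lemma dual_slope_continuous a : 0 <= a -> a < (beta - m)^-1 ->
  {for a, continuous (dual_slope : R -> R)}.
Proof.
move=> a0 am; rewrite /dual_slope; apply: cvg_big; first exact: add_continuous.
move=> s _.
apply: cvgM; first exact: cvg_cst.
apply: cvgV; first by rewrite gt_eqF// denom_gt0.
apply: cvgD; first exact: cvg_cst.
by apply: cvgM; [exact: cvg_id|exact: cvg_cst].
Qed.

(* As a tends to 1 / (beta - m), the term of a minimal component of b drives
   the slope to -oo; c is chosen so that this term cancels all the others. *)
Lemma dual_slope_root : (exists s, b 0 s = m) ->
  exists a, [/\ 0 <= a, a < (beta - m)^-1 & dual_slope a = 0].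
Proof.
move=> [s0 bs0].
have M0 : 0 < dual_slope 0 by rewrite dual_slope0 subr_gt0.
have bm : 0 < beta - m by rewrite subr_gt0.
have p0 := pbar_gt0 s0.
set M := dual_slope 0 in M0; set k := pbar 0 s0 * (beta - m).
have k0 : 0 < k by rewrite mulr_gt0.
(* [e] will be [denom c s0], so the term of [s0] at [c] is -k / e = -(M + k). At 0 that term is -k,
   so the others sum to M + k there, and each of them is no larger at [c]. *)
pose e := k / (M + k).
have Mk0 : 0 < M + k by rewrite addr_gt0.
have e0 : 0 < e by rewrite divr_gt0.
have e1 : e < 1 by rewrite ltr_pdivrMr// mul1r; lra.
pose c := (1 - e) / (beta - m).
have c0 : 0 <= c by rewrite divr_ge0 ?ltW// subr_gt0.
have cm : c < (beta - m)^-1.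
  by rewrite /c ltr_pdivrMr// mulVf ?gt_eqF//; lra.
have slopec : dual_slope c <= 0.
  have -> : dual_slope c = \sum_(s | s != s0)
      pbar 0 s * (b 0 s - beta) / denom c s - (M + k).
    rewrite /dual_slope (bigD1 s0)//= addrC; congr (_ + _).
    have -> : denom c s0 = e.
      rewrite /denom bs0 /c -[m - beta]opprB mulrN divfK ?gt_eqF//; ring.
    rewrite bs0 -[m - beta]opprB mulrN -/k /e mulNr; congr (- _).
    by rewrite invf_div mulrCA divff ?mulr1// gt_eqF.
  have -> : M + k = \sum_(s | s != s0) pbar 0 s * (b 0 s - beta).
    have -> : M = \sum_s pbar 0 s * (b 0 s - beta).
      by apply: eq_bigr => s _; rewrite /denom mul0r addr0 divr1.
    by rewrite (bigD1 s0)//= bs0 /k; ring.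
  rewrite subr_le0; apply: ler_sum => s _.
  rewrite ler_pdivrMr ?denom_gt0// -subr_ge0 /denom.
  have -> : pbar 0 s * (b 0 s - beta) * (1 + c * (b 0 s - beta)) -
    pbar 0 s * (b 0 s - beta) = pbar 0 s * c * (b 0 s - beta) ^+ 2 by ring.
  by rewrite mulr_ge0 ?sqr_ge0// mulr_ge0// ltW.
have slope_cont : {within `[0, c]%classic, continuous (dual_slope : R -> R)}%classic.
  apply: continuous_in_subspaceT => x; rewrite inE /= in_itv /= => /andP[x0 xc].
  by apply: dual_slope_continuous => //; exact: le_lt_trans cm.
have [|a] := @IVT _ _ _ _ 0 c0 slope_cont.
  by rewrite ge_min slopec orbT le_max (ltW M0).
rewrite in_itv /= => /andP[a0 ac] ?.
by exists a; split=> //; exact: le_lt_trans cm.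
Qed.

End Dual.

(** * Total-correctness rules with time bounds *)

Section Runs.
Variable R : realType.
Implicit Types (m : memory R) (Q : memory R -> Prop) (T : nat).

(** A Hoare triple from a fixed start. The time is only an upper bound, so that branches of unequal
    cost fit one [T]. *)
Definition runs c m T Q : Prop :=
  exists m' t, [/\ exec c m m' t, (t <= T)%N & Q m'].

Lemma runs_le T c m T' Q : runs c m T Q -> (T <= T')%N -> runs c m T' Q.
Proof.
move=> [m' [t [ex tT Qm']]] TT'; exists m', t; split=> //.
exact: leq_trans TT'.
Qed.

Lemma runs_imply Q c m T Q' : runs c m T Q -> (forall m', Q m' -> Q' m') ->
  runs c m T Q'.
Proof. by move=> [m' [t [ex tT /[swap]/[apply] Qm']]]; exists m', t. Qed.

Lemma runs_skip m Q : Q m -> runs Skip m 0 Q.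
Proof. by move=> Qm; exists m, 0%N; split=> //; constructor. Qed.

Lemma runs_iset m x e Q : Q (iset m x (ieval m e)) ->
  runs (ISet x e) m (icost e).+1 Q.
Proof. by move=> Qm; do 2!eexists; split; [constructor| |exact: Qm]. Qed.

Lemma runs_rset m x e v Q : reval m e = Some v -> Q (rset m x v) ->
  runs (RSet x e) m (rcost e).+1 Q.
Proof.
by move=> ev Qm; do 2!eexists; split; [constructor; exact: ev| |exact: Qm].
Qed.

Lemma runs_seq c1 c2 m T1 T2 Q :
  runs c1 m T1 (fun m' => runs c2 m' T2 Q) -> runs (Seq c1 c2) m (T1 + T2)%N Q.
Proof.
move=> [m1 [t1 [ex1 le1 [m2 [t2 [ex2 le2 Qm2]]]]]].
exists m2, (t1 + t2)%N; split=> //; last exact: leq_add.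
exact: ExecSeq ex1 ex2.
Qed.

Lemma runs_if c c1 c2 m v T Q : teval m c = Some v ->
  runs (if v then c1 else c2) m T Q -> runs (If c c1 c2) m (tcost c + T)%N Q.
Proof.
move=> ev [m' [t [ex le Qm']]]; exists m', (tcost c + t)%N; split=> //.
- by case: v ev ex => ev ex; [exact: ExecIfTrue|exact: ExecIfFalse].
- by rewrite leq_add2l.
Qed.

(** The index of [I] is a budget of iterations: entering the body consumes one unit, and leaving
    with units to spare is allowed. *)
Lemma runs_while c c1 (I : nat -> memory R -> Prop) k m T Q :
  (forall k m, I k m ->
     teval m c = Some false /\ Q m \/
     teval m c = Some true /\ exists2 k', k = k'.+1 & runs c1 m T (I k')) ->
  I k m -> runs (While c c1) m (k * (tcost c + T) + tcost c)%N Q.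
Proof.
move=> step; elim: k m => [|k IH] m Im;
    have [[evF Qm]|[evT [k' ek body]]] := step _ _ Im => //.
- by exists m, (tcost c); split=> //; exact: ExecWhileFalse.
- by exists m, (tcost c); split=> //; [exact: ExecWhileFalse|exact: leq_addl].
- case: ek body => <- [m1 [t1 [ex1 le1 Im1]]].
  have [m2 [t2 [ex2 le2 Qm2]]] := IH _ Im1.
  exists m2, (tcost c + t1 + t2)%N; split=> //.
  + exact: ExecWhileTrue ex1 ex2.
  + by rewrite mulSn -!addnA leq_add2l leq_add// addnA.
Qed.

(* Integer register 1 runs from 0 to the value of integer register 0. *)
Definition for_loop (body : cmd) : cmd :=
  Seq (ISet 1 (IConst 0))
      (While (ILt (IReg 1) (IReg 0))
             (Seq body (ISet 1 (IAdd (IReg 1) (IConst 1))))).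

(** [I] must not depend on the counter register. The 7 is a test (3) plus an increment (4); the 5 is
    the initialization (2) plus the final test (3). *)
Lemma runs_for body (I : nat -> memory R -> Prop) N m T Q :
  (forall k m, I k m -> ireg m 0 = N) ->
  (forall k m j, I k m -> I k (iset m 1 j)) ->
  (forall k m, (k < N)%N -> ireg m 1 = k -> I k m ->
     runs body m T (fun m' => ireg m' 1 = k /\ I k.+1 m')) ->
  I 0%N m -> (forall m', I N m' -> Q m') ->
  runs (for_loop body) m (N * (T + 7) + 5)%N Q.
Proof.
move=> IN Iset Ibody I0 IQ.
have loop m1 : ireg m1 1 = 0%N -> I 0%N m1 ->
    runs (While (ILt (IReg 1) (IReg 0))
             (Seq body (ISet 1 (IAdd (IReg 1) (IConst 1))))) m1
      (N * (3 + (T + 4)) + 3)%N Q.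
  (* [runs_while] counts iterations left, [I] iterations done. *)
  move=> r1 I1; pose J k m2 := [/\ (k <= N)%N, ireg m2 1 = (N - k)%N & I (N - k)%N m2].
  apply: (@runs_while _ _ J); last by split; rewrite ?subnn.
  move=> k m2 [kN r Ik]; rewrite /= (IN _ _ Ik) r.
  case: k kN r Ik => [|k] kN r Ik.
    by left; rewrite subn0 ltnn; split=> //; apply: IQ; rewrite -[N]subn0.
  right; have ltN : (N - k.+1 < N)%N by lia.
  split; [by rewrite ltN|exists k => //].
  apply: runs_seq; apply: (runs_imply (Ibody _ _ ltN r Ik)) => // m3 [r3 Ik3].
  apply: runs_iset; rewrite /= r3; split.
  - exact: ltnW.
  - by rewrite /= /upd /=; lia.
  - by apply: Iset; have <- : (N - k.+1).+1 = (N - k)%N by lia.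
apply: (runs_le (T := (2 + (N * (3 + (T + 4)) + 3))%N)) => //; last by nia.
by apply: runs_seq; apply: runs_iset; apply: loop => //; exact: Iset.
Qed.

Definition sum_loop (r : nat) (e : rexp) : cmd :=
  Seq (RSet r (RConst 0)) (for_loop (RSet r (RAdd (RReg r) e))).

Definition sum_cost (N : nat) (e : rexp) : nat := (N * (rcost e + 10) + 7)%N.

(** [P] is the frame: whatever the caller knows that survives writes to the counter and to the
    accumulator [r]. *)
Lemma runs_sum r e (N : nat) (G : 'I_N -> R) (P : memory R -> Prop) m Q :
  (forall m, P m -> ireg m 0 = N) ->
  (forall m j, P m -> P (iset m 1 j)) ->
  (forall m v, P m -> P (rset m r v)) ->
  (forall m (s : 'I_N), P m -> ireg m 1 = s -> reval m e = Some (G s)) ->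
  P m -> (forall m', P m' -> rreg m' r = \sum_s G s -> Q m') ->
  runs (sum_loop r e) m (sum_cost N e) Q.
Proof.
move=> PN Pi Pr Pe Pm PQ.
(* Extension of [G] by 0 to all naturals, so that partial sums can be stated. *)
pose F i := oapp G 0 (insub i).
pose I k m1 := P m1 /\ rreg m1 r = \sum_(0 <= i < k) F i.
apply: (runs_le (T := (2 + (N * ((rcost (RAdd (RReg r) e)).+1 + 7) + 5))%N)) => //;
  last by rewrite /sum_cost /=; nia.
apply: runs_seq; apply: runs_rset => //.
apply: (@runs_for _ I N).
- by move=> k m1 [/PN].
- by move=> k m1 j [/Pi].
- move=> k m1 kN r1 [P1 s1]; have ev := Pe _ (Ordinal kN) P1 r1.
  apply: runs_rset; first by rewrite /= ev s1.
  split=> //; split; first exact: Pr.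
  by rewrite /= /upd eqxx big_nat_recr//=; congr (_ + _); rewrite /F insubT.
- by split; [exact: Pr|rewrite /= /upd eqxx big_geq].
- move=> m1 [P1 s1]; apply: PQ => //; rewrite s1 big_mkord.
  by apply: eq_bigr => s _; rewrite /F valK.
Qed.

End Runs.

(** * The bisection program and its loop invariants *)

Section Bisection.

Definition deviation : rexp := RSub (RGet 1 (IReg 1)) (RReg 0).

Definition weighted_deviation : rexp := RMul (RGet 0 (IReg 1)) deviation.

Definition denom_exp (r : nat) : rexp :=
  RAdd (RConst 1) (RMul (RReg r) deviation).

Definition slope_term (r : nat) : rexp := RDiv weighted_deviation (denom_exp r).

Definition dual_term (r : nat) : rexp :=
  RMul (RGet 0 (IReg 1)) (RLn (denom_exp r)).

Definition min_step : cmd :=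
  If (RLe (RGet 1 (IReg 1)) (RReg 3)) (RSet 3 (RGet 1 (IReg 1))) Skip.

Definition min_loop : cmd :=
  Seq (RSet 3 (RGet 1 (IConst 0))) (for_loop min_step).

Definition bisection_step : cmd :=
  Seq (RSet 4 (RDiv (RReg 4) (RConst 2)))
 (Seq (RSet 6 (RAdd (RReg 5) (RReg 4)))
 (Seq (sum_loop 7 (slope_term 6))
      (If (RLe (RReg 7) (RConst 0)) Skip (RSet 5 (RReg 6))))).

(* Real registers: 2 holds the slope of the dual at 0, 3 the minimum of b,
   [r5, r5 + r4] brackets the maximizer, 6 is its midpoint, 7 accumulates. *)
Definition bisection : cmd :=
  Seq (sum_loop 2 weighted_deviation)
 (Seq min_loop
 (Seq (RSet 4 (RDiv (RConst 1) (RSub (RReg 0) (RReg 3))))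
 (Seq (RSet 5 (RConst 0))
 (Seq (While (RLe (RReg 1) (RMul (RReg 2) (RReg 4))) bisection_step)
 (Seq (sum_loop 7 (dual_term 5))
 (Seq (RSet 0 (RReg 7))
      (RSet 1 (RAdd (RReg 0) (RReg 1))))))))).

Variables (R : realType) (n : nat) (pbar b : 'rV[R]_n.+1) (beta delta : R).
Implicit Types m : memory R.

Definition holds_input m : Prop :=
  [/\ ireg m 0 = n.+1, forall s : 'I_n.+1, rarr m 0 s = pbar 0 s,
      forall s : 'I_n.+1, rarr m 1 s = b 0 s, rreg m 0 = beta & rreg m 1 = delta].

Lemma input_holds : holds_input (input pbar b beta delta).
Proof. by split=> // s; rewrite /= /upd /= /vec_array valK. Qed.

Lemma reval_weighted_deviation m (s : 'I_n.+1) :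
  holds_input m -> ireg m 1 = s ->
  reval m weighted_deviation = Some (pbar 0 s * (b 0 s - beta)).
Proof. by move=> [_ p0 b0 r0 _] is1; rewrite /= is1 p0 b0 r0. Qed.

Lemma reval_denom m r (s : 'I_n.+1) :
  holds_input m -> ireg m 1 = s ->
  reval m (denom_exp r) = Some (denom b beta (rreg m r) s).
Proof. by move=> [_ p0 b0 r0 _] is1; rewrite /= is1 b0 r0. Qed.

Lemma reval_div m e1 e2 x y : reval m e1 = Some x -> reval m e2 = Some y ->
  y != 0 -> reval m (RDiv e1 e2) = Some (x / y).
Proof. by move=> /= -> -> /negbTE /= ->. Qed.

Lemma reval_mul_ln m e1 e2 x y : reval m e1 = Some x -> reval m e2 = Some y ->
  0 < y -> reval m (RMul e1 (RLn e2)) = Some (x * ln y).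
Proof. by move=> /= -> -> /= ->. Qed.

Local Notation dual := (dual pbar b beta).
Local Notation dual_slope := (dual_slope pbar b beta).
Local Notation denom := (denom b beta).
Local Notation M := (dual_slope 0).

Lemma runs_dual_slope m (P : memory R -> Prop) r a Q :
  (forall m, P m -> holds_input m) ->
  (forall m j, P m -> P (iset m 1 j)) ->
  (forall m v, P m -> P (rset m 7 v)) ->
  (forall m, P m -> rreg m r = a) ->
  (forall s, 0 < denom a s) ->
  P m -> (forall m', P m' -> rreg m' 7 = dual_slope a -> Q m') ->
  runs (sum_loop 7 (slope_term r)) m (sum_cost n.+1 (slope_term r)) Q.
Proof.
move=> Pin Pi Pr Pa d0 Pm; apply: runs_sum => // [m1 /Pin[]//|m1 s P1 is1].
apply: reval_div; first exact: reval_weighted_deviation (Pin _ P1) is1.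
  by rewrite (reval_denom _ (Pin _ P1) is1) (Pa _ P1).
by rewrite gt_eqF.
Qed.

Lemma runs_dual m (P : memory R -> Prop) r a Q :
  (forall m, P m -> holds_input m) ->
  (forall m j, P m -> P (iset m 1 j)) ->
  (forall m v, P m -> P (rset m 7 v)) ->
  (forall m, P m -> rreg m r = a) ->
  (forall s, 0 < denom a s) ->
  P m -> (forall m', P m' -> rreg m' 7 = dual a -> Q m') ->
  runs (sum_loop 7 (dual_term r)) m (sum_cost n.+1 (dual_term r)) Q.
Proof.
move=> Pin Pi Pr Pa d0 Pm; apply: runs_sum => // [m1 /Pin[]//|m1 s P1 is1].
apply: reval_mul_ln (d0 s).
  by have [_ p0 _ _ _] := Pin _ P1; rewrite /= is1 p0.
by rewrite (reval_denom _ (Pin _ P1) is1) (Pa _ P1).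
Qed.

Lemma runs_slope0 m Q : holds_input m ->
  (forall m', holds_input m' -> rreg m' 2 = M -> Q m') ->
  runs (sum_loop 2 weighted_deviation) m (sum_cost n.+1 weighted_deviation) Q.
Proof.
move=> im IQ.
apply: (@runs_sum _ _ _ _ (fun s => pbar 0 s * (b 0 s - beta)) holds_input)
  => // [m1 []//|m1 s|m1 im1 r1].
  exact: reval_weighted_deviation.
apply: IQ => //; rewrite r1; apply: eq_bigr => s _.
by rewrite /denom mul0r addr0 divr1.
Qed.

Lemma runs_min m Q : holds_input m -> rreg m 2 = M ->
  (forall m', holds_input m' -> rreg m' 2 = M ->
     (forall s, rreg m' 3 <= b 0 s) -> (exists s, b 0 s = rreg m' 3) -> Q m') ->
  runs min_loop m
    (n.+1 * 14 + 8)%N Q.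
Proof.
move=> im r2 IQ.
(* The last clause holds from the start because register 3 is seeded with component 0 of [b]. *)
pose I k m1 := [/\ holds_input m1, rreg m1 2 = M,
  forall s : 'I_n.+1, (s < k)%N -> rreg m1 3 <= b 0 s
  & exists s, b 0 s = rreg m1 3].
apply: (runs_le (T := (3 + (n.+1 * (7 + 7) + 5))%N)); last by lia.
apply: runs_seq; apply: runs_rset => //.
apply: (@runs_for _ _ I n.+1).
- by move=> k m1 [[]].
- by [].
- move=> k m1 kn r1 [im1 r12 le3 ex3].
  have [_ _ b1 _ _] := im1; have bk := b1 (Ordinal kn).
  apply: (runs_le (T := (4 + 3)%N)) => //.
  apply: runs_if => /=; first by rewrite r1.
  rewrite bk; case: ifPn => [le|].
    apply: runs_rset => //=; split=> //; split=> //=; last first.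
      by exists (Ordinal kn); rewrite /upd /= r1 bk.
    move=> s; rewrite ltnS leq_eqVlt /upd /= r1 bk => /orP[/eqP sk|sk].
      by rewrite (_ : s = Ordinal kn)//; exact: val_inj.
    exact: le_trans (le3 _ sk).
  rewrite -ltNge => lt; apply: (runs_le (T := 0%N)) => //; apply: runs_skip.
  split=> //; split=> // s; rewrite ltnS leq_eqVlt => /orP[/eqP sk|].
    by rewrite (_ : s = Ordinal kn) ?ltW//; exact: val_inj.
  exact: le3.
- split=> //; exists ord0; have [_ _ b1 _ _] := im.
  by rewrite /= /upd /= -(b1 ord0).
- by move=> m1 [im1 r12 le3 ex3]; apply: IQ => // s; exact: le3.
Qed.

Hypothesis pbar_gt0 : forall s, 0 < pbar 0 s.
(** The pole bounding the dual's domain, later [(beta - mn)^-1] for the computed minimum [mn]. *)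
Variable lo_max : R.
Hypothesis denom_pos : forall a s, 0 <= a -> a < lo_max -> 0 < denom a s.

(* The count k bounds the number of remaining bisection steps. *)
Definition bracket (k : nat) m : Prop :=
  [/\ holds_input m, rreg m 2 = M, M * rreg m 4 < delta * 2 ^+ k &
   [/\ 0 <= rreg m 5, 0 < rreg m 4, rreg m 5 + rreg m 4 <= lo_max &
    exists a, [/\ rreg m 5 <= a, a <= rreg m 5 + rreg m 4, a < lo_max
                & dual_slope a = 0]]].

Definition step_cost : nat :=
  (4 + (4 + (sum_cost n.+1 (slope_term 6) + (3 + 2))))%N.

Lemma runs_bisection_step k m : bracket k.+1 m ->
  runs bisection_step m step_cost (bracket k).
Proof.
move=> [im r2 Mw [lo0 w0 lo_w [a [lo_a a_hi a_max slope_a]]]].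
set lo := rreg m 5 in lo0 lo_w lo_a a_hi; set w := rreg m 4 in Mw w0 lo_w a_hi.
have w20 : 0 < w / 2 by lra.
have wE : w = w / 2 + w / 2 by lra.
have M2 : M * (w / 2) < delta * 2 ^+ k.
  by move: Mw; rewrite exprSr; lra.
have mid0 : 0 <= lo + w / 2 by lra.
have mid_max : lo + w / 2 < lo_max by lra.
apply: runs_seq; apply: runs_rset; first by rewrite /= pnatr_eq0.
apply: runs_seq; apply: runs_rset => //=.
pose P m1 := [/\ holds_input m1, rreg m1 2 = M, rreg m1 4 = w / 2,
  rreg m1 5 = lo & rreg m1 6 = lo + w / 2].
apply: runs_seq; apply: (@runs_dual_slope _ P _ (lo + w / 2)) => //.
- by move=> m1 [].
- by move=> m1 [].
- by move=> s; exact: denom_pos.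
move=> m1 [im1 r12 r14 r15 r16] r17.
apply: runs_if => /=; first by [].
rewrite r17; case: ifPn => [slope_le|].
  apply: (runs_le (T := 0%N)) => //; apply: runs_skip.
  split=> //; rewrite r14 ?r15//; split=> //; first lra.
  have [am|ma] := leP a (lo + w / 2); first by exists a.
  (* The known root lies to the right, so monotonicity makes the slope here nonnegative, hence zero:
     the midpoint is a root too. *)
  exists (lo + w / 2); split=> //; first lra.
  apply/eqP; rewrite eq_le slope_le -slope_a.
  apply: dual_slope_nonincreasing => // [|s|s]; first exact: ltW.
  - exact: denom_pos.
  - by apply: denom_pos => //; lra.
rewrite -ltNge => slope_gt; apply: runs_rset => //=.
split=> //=; rewrite /upd /= r14 ?r16//; split=> //; first lra.
exists a; split=> //; last lra.
rewrite leNgt; apply/negP => am.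
have : dual_slope (lo + w / 2) <= dual_slope a.
  apply: dual_slope_nonincreasing => // [|s|s]; first exact: ltW.
  - by apply: denom_pos => //; lra.
  - exact: denom_pos.
by rewrite slope_a leNgt slope_gt.
Qed.

(** A failing test is exactly the width clause of [bracket 0], whatever [k] remains; at k = 0 that
    clause forces the test to fail. *)
Lemma runs_bisection_loop k m Q : bracket k m ->
  (forall m', bracket 0 m' -> Q m') ->
  runs (While (RLe (RReg 1) (RMul (RReg 2) (RReg 4))) bisection_step) m
    (k * (5 + step_cost) + 5)%N Q.
Proof.
move=> bm bQ; apply: runs_while bm => {}k {}m bm.
have [im r2 Mw br] := bm; have [_ _ _ _ r1] := im.
rewrite /= r1; have [le|lt] := leP; [right|left]; last first.
  by split=> //; apply: bQ; split=> //; rewrite expr0 mulr1 -r2.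
split=> //; case: k bm Mw => [|k] bm Mw.
  by move: le; rewrite r2 leNgt -[delta in _ < delta]mulr1 Mw.
by exists k => //; exact: runs_bisection_step.
Qed.

End Bisection.

(** * Correctness and running time of the whole program *)

Lemma runs_bisection (R : realType) (n : nat) (pbar b : 'rV[R]_n.+1)
    (beta omega delta : R) (K : nat) :
  simplex pbar -> (forall s, 0 < pbar 0 s) -> 0 <= beta ->
  beta < dot b pbar -> 0 < omega -> vmin b + omega <= beta -> 0 < delta ->
  vmax b / (delta * omega) < 2 ^+ K ->
  runs bisection (input pbar b beta delta) (100 * n.+1 * K.+1)%N
    (fun m => solves_to_accuracy pbar b beta delta (rreg m 0) (rreg m 1)).
Proof.
move=> sp p0 beta0 bp omega0 vmin_le delta0 ltK.
set M := dual_slope pbar b beta 0.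
have M0 : 0 < M by rewrite /M dual_slope0// subr_gt0.
have M_le : M <= vmax b.
  rewrite /M dual_slope0// lerBlDr; apply: (@le_trans _ _ (vmax b)); last first.
    by rewrite lerDl.
  rewrite -[leRHS]mulr1 -sp.2 mulr_sumr; apply: ler_sum => s _.
  by rewrite ler_pM2r// le_bigmax.
(* Costs in program order: at most 51 n.+1 per bisection step and 94 n.+1 outside the loop, whence
   the factor 100. *)
apply: (runs_le (T := (sum_cost n.+1 weighted_deviation + (n.+1 * 14 + 8 + (6 + (2
   + (K * (5 + step_cost n) + 5 + (sum_cost n.+1 (dual_term 5) + (2 + 4)))))))%N));
  last by rewrite /step_cost /sum_cost /=; nia.
apply: runs_seq; apply: runs_slope0 => [|m im r2]; first exact: input_holds.
apply: runs_seq; apply: (runs_min im r2) => {im r2}m im r2 le3 ex3.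
set mn := rreg m 3 in le3 ex3.
have mn_omega : omega <= beta - mn.
  suff : mn <= vmin b by lra.
  exact: le_bigmin.
have mn_beta : 0 < beta - mn by lra.
have [_ _ _ r0 _] := im.
apply: runs_seq; apply: (runs_rset (v := (beta - mn)^-1)).
  by rewrite /= r0 -/mn gt_eqF// div1r.
apply: runs_seq; apply: runs_rset => //=.
have mn_lt : mn < beta by rewrite -subr_gt0.
have d0 (a : R) s : 0 <= a -> a < (beta - mn)^-1 -> 0 < denom b beta a s.
  exact: denom_gt0.
have [a [a0 a_max slope_a]] := dual_slope_root sp p0 bp mn_lt le3 ex3.
apply: runs_seq; apply: (@runs_bisection_loop _ _ pbar b beta delta p0 (beta - mn)^-1 d0 K).
  split=> //=; rewrite /upd /=.
    rewrite -/M -ltr_pdivrMl//; apply: le_lt_trans ltK.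
    have -> : delta^-1 * (M * (beta - mn)^-1) = (M / delta) * (beta - mn)^-1.
      by rewrite mulrCA mulrA.
    rewrite invfM mulrA; apply: ler_pM.
    - by rewrite ltW// divr_gt0.
    - by rewrite ltW// invr_gt0.
    - by rewrite ler_pM2r ?invr_gt0.
    - by rewrite lef_pV2 ?posrE.
  split=> //; first by rewrite invr_gt0.
    by rewrite add0r.
  by exists a; split=> //; rewrite add0r ltW.
move=> {im r0}m1 [im1 r12 Mw [lo0 w0 lo_w [c [lo_c c_hi c_max slope_c]]]].
pose P m2 := [/\ holds_input pbar b beta delta m2 & rreg m2 5 = rreg m1 5].
set lo := rreg m1 5 in lo0 lo_w lo_c c_hi P; set w := rreg m1 4 in w0 lo_w c_hi Mw.
have dlo s : 0 < denom b beta lo s by apply: d0 => //; lra.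
have dc s : 0 < denom b beta c s by apply: d0 => //; lra.
apply: runs_seq; apply: (@runs_dual _ _ pbar b beta delta m1 P 5 lo) => //.
- by move=> m2 [].
- by move=> m2 [].
move=> m2 [im2 _] r7; have [_ _ _ _ r1] := im2.
(* The output interval is [dual lo] to [dual lo + delta]; it overwrites beta and delta. *)
apply: runs_seq; apply: runs_rset => //; apply: runs_rset => //=.
rewrite /upd /= r7 r1; split; last lra.
exists (dual pbar b beta c)%:E; first by apply: strong_duality => //; lra.
rewrite !lee_fin.
have sd : is_projection_value pbar b beta (dual pbar b beta c)%:E.
  by apply: strong_duality => //; lra.
(* Lower end: weak duality at [lo], applied to the optimal [p]. *)
apply/andP; split.
  have [[p fp /esym pE] _] := sd.
  by rewrite -lee_fin pE; exact: weak_duality.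
apply: (le_trans (dual_concave p0 dlo dc)); rewrite lerD2l.
have slope_lo : dual_slope pbar b beta lo <= M.
  by apply: dual_slope_nonincreasing => // s; apply: d0; rewrite ?invr_gt0.
have : dual_slope pbar b beta lo * (c - lo) <= M * (c - lo).
  by rewrite ler_wpM2r// subr_ge0.
have : M * (c - lo) <= M * w by rewrite ler_wpM2l//; [exact: ltW|lra].
by move: Mw; rewrite expr0 mulr1 -/M; lra.
Qed.

(* The dimension S is n.+1.  The program and the constant of the O(...) are
   uniform in all the data.  The logarithm is read as max(1, log), since it may
   be arbitrarily small or negative (delta is unrestricted) whereas a running
   time may not. *)
Theorem theorem3 (R : realType) :
  exists (algo : cmd) (C : R),
  forall (n : nat) (pbar b : 'rV[R]_n.+1) (beta : R),
    simplex pbar ->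
    (forall s, 0 < pbar 0 s) ->
    (forall s, 0 <= b 0 s) ->
    0 <= beta ->
    beta < dot b pbar ->
  forall omega : R, 0 < omega -> vmin b + omega <= beta ->
  forall delta : R, 0 < delta ->
    solves_within algo pbar b beta delta
      (C * (n.+1%:R * Num.max 1 (ln (vmax b / (delta * omega))))).
Proof.
have ln2_gt0 : 0 < ln (2 : R) by rewrite ln_gt0// ltr1n.
(* [(ln 2)^-1] converts to base 2; the 2 pays for the rounding in [K.+1], as 1 <= L. *)
exists bisection, (100 * ((ln 2)^-1 + 2)).
move=> n pbar b beta sp p0 b0 beta0 bp omega omega0 vmin_le delta delta0.
set X := vmax b / (delta * omega); set L := Num.max 1 (ln X).
have L1 : 1 <= L by rewrite le_max lexx.
pose K := (Num.truncn (L / ln 2)).+1.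
have Kle : K.+1%:R <= ((ln 2)^-1 + 2) * L.
  rewrite -[K.+1]addn2 natrD mulrDl lerD//; last by rewrite ler_peMr.
  by rewrite [leRHS]mulrC truncn_le divr_ge0// ltW// (lt_le_trans ltr01).
have ltK : X < 2 ^+ K.
  (* Logarithms can be compared only for positive [X]; otherwise any power of 2 exceeds it. *)
  have [X0|X0] := leP X 0; first by apply: le_lt_trans X0 _; rewrite exprn_gt0.
  rewrite -ltr_ln ?posrE ?exprn_gt0// lnXn// -[ltRHS]mulr_natl.
  rewrite -ltr_pdivrMr//; apply: le_lt_trans (truncnS_gt _).
  by rewrite ler_pM2r ?invr_gt0// le_max lexx orbT.
have [m [t [ex tT solves]]] := runs_bisection sp p0 beta0 bp omega0 vmin_le delta0 ltK.
exists m, t; split=> //.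
apply: (@le_trans _ _ (100 * n.+1 * K.+1)%N%:R); first by rewrite ler_nat.
rewrite !natrM.
have -> : 100 * ((ln 2)^-1 + 2) * (n.+1%:R * L) =
    100 * n.+1%:R * (((ln 2)^-1 + 2) * L) by ring.
by rewrite ler_wpM2l.
Qed.
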